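(* Let $I\subset K[x_1,\ldots,x_n]$ be a graded ideal. There exists a non-empty Zariski-open subset $U\subset \mathrm{GL}_n(K)$ such that for every $g\in U$ there is a universal Gröbner basis $\mathcal{G}(g)=\{h_1(g),\ldots,h_s(g)\}$ of $g(I)$, and all these universal Gröbner bases $\mathcal{G}(g)$, $g\in U$, have the same support.
   Context: $K$ is an algebraically closed field of characteristic $0$. Each $g=(g_{ij})\in\mathrm{GL}_n(K)$ is identified with the $K$-algebra automorphism of $K[x_1,\ldots,x_n]$ given by $x_i\mapsto \sum_{j=1}^n g_{ij}x_j$, and $g(I)$ denotes the image of $I$. $\mathrm{GL}_n(K)$ carries the Zariski topology induced from $K^{n\times n}$. A universal Gröbner basis of $I$ is a finite generating set of $I$ that is a Gröbner basis of $I$ with respect to every term order. The support of a polynomial is the set of its exponent vectors (of terms with nonzero coefficient); the support of a finite set of polynomials is the set of the supports of its elements. *)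

(* Defs.v *)
From HB Require Import structures.
From mathcomp Require Import all_boot all_order all_algebra.
From mathcomp Require Import finmap.
From mathcomp Require Export mpoly.
Set Implicit Arguments. Unset Strict Implicit. Unset Printing Implicit Defensive.
Import Order.TTheory GRing.Theory.
Local Open Scope ring_scope.

Section GB.
Variables (K : fieldType) (n : nat).
Local Notation P := {mpoly K[n]}.
Local Notation mon := 'X_{1..n}.

Definition is_ideal (I : P -> Prop) : Prop :=
  [/\ I 0, (forall p q, I p -> I q -> I (p + q)) & (forall a p, I p -> I (a * p))].

Definition homog_part (d : nat) (p : P) : P :=
  \sum_(m <- msupp p | mdeg m == d) p@_m *: 'X_[m].

Definition graded_ideal (I : P -> Prop) : Prop :=
  is_ideal I /\ forall p, I p -> forall d, I (homog_part d p).

Definition gen_ideal (G : seq P) (p : P) : Prop :=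
  exists a : seq P, size a = size G /\ p = \sum_(i < size G) a`_i * G`_i.

Definition term_order (le : rel mon) : Prop :=
  [/\ reflexive le, antisymmetric le, transitive le & total le] /\
  [/\ (forall m, le 0%MM m) &
      (forall m1 m2 m, le m1 m2 -> le (m1 + m)%MM (m2 + m)%MM)].

Definition is_lm (le : rel mon) (p : P) (m : mon) : Prop :=
  m \in msupp p /\ forall m', m' \in msupp p -> le m' m.

Definition mdivides (m1 m2 : mon) : Prop := forall i, (m1 i <= m2 i)%N.

Definition groebner_basis (le : rel mon) (I : P -> Prop) (G : seq P) : Prop :=
  (forall g, g \in G -> I g) /\
  forall p, I p -> p != 0 -> exists g mg mp,
    [/\ g \in G, is_lm le g mg, is_lm le p mp & mdivides mg mp].

Definition universal_GB (I : P -> Prop) (G : seq P) : Prop :=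
  (forall p, I p <-> gen_ideal G p) /\
  forall le, term_order le -> groebner_basis le I G.

Definition mpoly_supp (p : P) : {fset mon} := [fset m | m in msupp p]%fset.
Definition supp_set (G : seq P) : {fset {fset mon}} := [fset mpoly_supp h | h in G]%fset.

Definition act (g : 'M[K]_n) (p : P) : P :=
  comp_mpoly [tuple \sum_(j < n) g i j *: 'X_j | i < n] p.

Definition act_ideal (g : 'M[K]_n) (I : P -> Prop) (q : P) : Prop :=
  exists2 p, I p & q = act g p.

(* Zariski open subsets of GL_n(K) (topology induced from K^{n x n}):
   GL_n minus the common zero set of a family S of polynomials in the n*n
   matrix entries (coordinates ordered via mxvec). *)
Definition zariski_open_GL (U : 'M[K]_n -> Prop) : Prop :=
  exists S : {mpoly K[n * n]} -> Prop, forall g,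
    U g <-> (g \in unitmx /\ exists2 f, S f & f.@[fun k => mxvec g 0 k] != 0).
End GB.

(* Main.v *)
(* A linear subspace of polynomials of degree <= D contains, up to scalars, one
   element of each minimal nonempty support (circuit), and the leading monomials
   of its elements are those of its circuits, for every term order.  So the
   circuits of (gI)_{<=D} form a universal Groebner basis of gI as soon as every
   initial ideal of gI is generated in degree <= D.  Such a D exists uniformly in
   g and in the term order: all these initial ideals have the Hilbert function of
   I, and by Noetherian induction the monomial ideals with a given Hilbert
   function are generated in bounded degree.  Finally, that (gI)_{<=D} has no
   nonzero element supported in S is, for each of the finitely many S, an open
   condition on g; on the intersection of the nonempty conditions the set of
   supports of circuits is constant. *)

Require Import Defs.
From HB Require Import structures.
From mathcomp Require Import all_boot all_order all_algebra.
From mathcomp Require Import finmap.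
From mathcomp Require Import mpoly.
From mathcomp Require Import boolp.
Set Implicit Arguments. Unset Strict Implicit. Unset Printing Implicit Defensive.
Import Order.TTheory GRing.Theory.
Local Open Scope ring_scope.

(** * Dickson's lemma and degree bounds for monomial ideals with a given Hilbert function *)

Lemma nondecreasing_subseq (u : nat -> nat) :
  exists phi : nat -> nat, (forall i j, (i < j)%N -> (phi i < phi j)%N) /\
    forall i j, (i <= j)%N -> (u (phi i) <= u (phi j))%N.
Proof.
have tail_min N : exists j, (N <= j)%N /\ forall k, (j <= k)%N -> (u j <= u k)%N.
  have [v [Nv]] : exists j, (N <= j)%N /\ forall k, (N <= k)%N -> (u j <= u k)%N.
    pose P v := `[< exists2 j, (N <= j)%N & u j = v >].
    have exP : exists v, P v by exists (u N); apply/asboolP; exists N.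
    case: (ex_minnP exP) => v /asboolP [j Nj uj] vmin; exists j; split=> // k Nk.
    by rewrite uj; apply: vmin; apply/asboolP; exists k.
  by move=> vmin; exists v; split=> // k vk; apply: vmin; apply: leq_trans vk.
have [J HJ] := choice tail_min.
(* Every [phi i] is a value of [J], hence an index where [u] is at most all its later values. *)
pose phi i := iter i (fun k => J k.+1) (J 0%N).
have phiS i : (phi i < phi i.+1)%N by rewrite /= ; case: (HJ (phi i).+1).
have phimon : {homo phi : i j / (i < j)%N} by apply: homo_ltn => // ? ? ?; apply: ltn_trans.
exists phi; split=> // i j; rewrite leq_eqVlt => /predU1P [->|/phimon lij] //.
have [N eN] : exists N, phi i = J N.
  by case: i {lij} => [|i]; [exists 0%N | exists (phi i).+1].
by rewrite eN; apply: (HJ N).2; rewrite -eN ltnW.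
Qed.

Lemma dickson n (f : nat -> 'X_{1..n}) :
  exists i j, (i < j)%N /\ (f i <= f j)%MM.
Proof.
suff [phi [phi_lt phi_le]] : exists phi : nat -> nat,
    (forall i j, (i < j)%N -> (phi i < phi j)%N) /\
    forall c : 'I_n, (c < n)%N -> forall i j, (i <= j)%N -> (f (phi i) c <= f (phi j) c)%N.
  exists (phi 0%N), (phi 1%N); split; first exact: phi_lt.
  by apply/mnm_lepP => c; apply: phi_le.
(* Induction on the number of coordinates already made nondecreasing: each further coordinate costs
   one more extraction. *)
elim: {3}n => [|k [phi [phi_lt phi_le]]]; first by exists id.
case: (ltnP k n) => [ltkn|lenk]; last first.
  by exists phi; split=> // c _; apply: phi_le; apply: leq_trans lenk.
have [psi [psi_lt psi_le]] := nondecreasing_subseq (fun i => f (phi i) (Ordinal ltkn)).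
exists (phi \o psi); split=> [i j /psi_lt /phi_lt //|c].
rewrite ltnS leq_eqVlt => /predU1P [eck|ltck] i j leij /=.
  by rewrite (_ : c = Ordinal ltkn); [exact: psi_le | exact: val_inj].
apply: phi_le => //; move: leij; rewrite leq_eqVlt => /predU1P [->//|/psi_lt /ltnW //].
Qed.

Definition divisible_by n (s : seq 'X_{1..n}) (m : 'X_{1..n}) :=
  has (fun u => (u <= m)%MM) s.

(* Noetherian induction on monomial ideals, presented by finite generating lists. *)
Lemma mnm_noetherian_ind n (P : seq 'X_{1..n} -> Prop) :
  (forall s, (forall m, ~~ divisible_by s m -> P (m :: s)) -> P s) -> P [::].
Proof.
move=> IH; apply: contrapT => nP0.
have next (s : {s | ~ P s}) : exists m, ~~ divisible_by (sval s) m /\ ~ P (m :: sval s).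
  case: s => s nPs /=; apply: contrapT => nex; apply: nPs; apply: IH => m ndiv.
  by apply: contrapT => nPm; apply: nex; exists m.
have [M HM] := choice next.
(* Failing lists extend forever, which yields an infinite sequence of monomials, none divisible by
   an earlier one, against Dickson's lemma. *)
pose step s : {s | ~ P s} := exist _ (M s :: sval s) (HM s).2.
pose st k := iter k step (exist _ [::] nP0).
have [i [j [ltij lefij]]] := dickson (fun k => M (st k)).
have Min k : M (st i) \in sval (st (i.+1 + k)%N).
  by elim: k => [|k IHk]; rewrite ?addn0 ?addnS /= inE ?eqxx // IHk orbT.
have := (HM (st j)).1; rewrite -(subnKC ltij) in lefij *; case/negP.
by apply/hasP; exists (M (st i)).
Qed.

Definition monomial_ideal n (J : 'X_{1..n} -> Prop) :=
  forall m u, J m -> J (m + u)%MM.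

(** The affine Hilbert function of the ideal itself: a cumulative count, matching the dimensions of
    degree truncations. *)
Definition hilbert_function n (J : 'X_{1..n} -> Prop) (d : nat) :=
  #|[set m : 'X_{1..n < d.+1} | `[< J m >]]|.

(** Noetherian induction on a list [s] of monomials known to lie in [J]. If [s] already accounts for
    [h], then it generates [J]; otherwise [J] contains one of finitely many monomials outside the
    ideal of [s], and the bound is the largest one for the extended lists. *)
Lemma gen_degree_bound n (h : nat -> nat) : exists D, forall J : 'X_{1..n} -> Prop,
  monomial_ideal J -> hilbert_function J =1 h ->
  forall m, J m -> exists2 u, J u & (mdeg u <= D)%N && (u <= m)%MM.
Proof.
suff [D HD] : exists D, forall J : 'X_{1..n} -> Prop,
    monomial_ideal J -> hilbert_function J =1 h -> {in [::], forall u, J u} ->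
    forall m, J m -> exists2 u, J u & (mdeg u <= D)%N && (u <= m)%MM.
  by exists D => J JI Jh; apply: HD.
elim/mnm_noetherian_ind: [::] => s IH.
have sub J d : monomial_ideal J -> {in s, forall u, J u} ->
    [set m : 'X_{1..n < d.+1} | divisible_by s m] \subset
    [set m : 'X_{1..n < d.+1} | `[< J m >]].
  move=> JI sJ; apply/subsetP => m; rewrite !inE => /hasP [u us leum].
  by apply/asboolP; rewrite -(submK leum) addmC; apply/JI/sJ.
have [eqh|] := pselect (forall d, #|[set m : 'X_{1..n < d.+1} | divisible_by s m]| = h d).
  exists (\max_(u <- s) mdeg u)%N => J JI Jh sJ m Jm.
  have /eqP/setP/(_ (BMultinom (ltnSn (mdeg m)))) :
      [set m0 : 'X_{1..n < (mdeg m).+1} | divisible_by s m0] ==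
      [set m0 : 'X_{1..n < (mdeg m).+1} | `[< J m0 >]].
    by rewrite eqEcard sub // eqh -Jh /hilbert_function leqnn.
  rewrite !inE /= => eJ; have : divisible_by s m by rewrite eJ; apply/asboolP.
  case/hasP=> u us leum; exists u; first exact: sJ.
  by rewrite leum andbT (big_rem u) //= leq_maxl.
(* The degree [d] of the discrepancy depends on [s] and [h] only, so one finite set of candidates
   serves all [J]. *)
move/existsNP => [d /eqP neqh].
pose Q (m : 'X_{1..n < d.+1}) D := ~~ divisible_by s m -> forall J : 'X_{1..n} -> Prop,
  monomial_ideal J -> hilbert_function J =1 h -> {in bmnm m :: s, forall u, J u} ->
  forall v, J v -> exists2 u, J u & (mdeg u <= D)%N && (u <= v)%MM.
have /choice [F HF] : forall m, exists D, Q m D.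
  move=> m; have [divm|ndivm] := boolP (divisible_by s m).
    by exists 0%N; rewrite /Q divm.
  by have [D HD] := IH _ ndivm; exists D => _.
exists (\max_m F m)%N => J JI Jh sJ v Jv.
have : [set m : 'X_{1..n < d.+1} | divisible_by s m] \proper
       [set m : 'X_{1..n < d.+1} | `[< J m >]].
  by rewrite properEneq sub // andbT; apply: contraNneq neqh => ->; rewrite -Jh.
case/properP => _ [m]; rewrite !inE => /asboolP Jm ndivm.
have [|u Ju /andP [leu leuv]] := HF m ndivm J JI Jh _ v Jv.
  by move=> u; rewrite inE => /predU1P [->//|/sJ].
by exists u => //; rewrite leuv andbT (leq_trans leu) // leq_bigmax.
Qed.

(** * The linear action on polynomials and its compatibility with degrees and ideals *)

Section Action.
Variables (K : fieldType) (n : nat).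
Local Notation P := {mpoly K[n]}.
Implicit Types (g h : 'M[K]_n) (p q : P) (I J : P -> Prop).

HB.instance Definition _ g := GRing.LRMorphism.copy (act g)
  (comp_mpoly [tuple \sum_(j < n) g i j *: 'X_j | i < n] : P -> P).

Lemma actZ g c p : act g (c *: p) = c *: act g p.
Proof. exact: comp_mpolyZ. Qed.

Lemma act_sum g T (r : seq T) (F : T -> P) :
  act g (\sum_(i <- r) F i) = \sum_(i <- r) act g (F i).
Proof. exact: (raddf_sum (act g)). Qed.

Lemma act_XU g i : act g 'X_i = \sum_(j < n) g i j *: 'X_j.
Proof. by rewrite /act comp_mpolyXU nth_mktuple. Qed.

Lemma act_mpolyX g m : act g 'X_[m] = \prod_(i < n) (act g 'X_i) ^+ m i.
Proof. by rewrite mpolyXE_id rmorph_prod; apply: eq_bigr => i _; rewrite rmorphXn. Qed.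

(** Substitution reverses the order of the matrices. Both sides are algebra morphisms, so it
    suffices to compare them on the variables. *)
Lemma act_mul g h p : act g (act h p) = act (h *m g) p.
Proof.
rewrite [p]mpolyE (act_sum h) (act_sum g) (act_sum (h *m g)); apply: eq_bigr => m _.
rewrite !actZ !act_mpolyX (rmorph_prod (act g)); congr (_ *: _); apply: eq_bigr => i _.
rewrite rmorphXn /=; congr (_ ^+ _); rewrite (act_XU h) (act_XU (h *m g)) act_sum.
under eq_bigr => j _ do rewrite actZ act_XU scaler_sumr.
rewrite exchange_big /=; apply: eq_bigr => k _; rewrite mxE scaler_suml.
by apply: eq_bigr => j _; rewrite scalerA.
Qed.

Lemma act1 p : act 1%:M p = p.
Proof.
rewrite -[RHS]comp_mpoly_id /act; congr comp_mpoly; apply: eq_mktuple => i.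
rewrite (bigD1 i) //= mxE eqxx scale1r big1 ?addr0 // => j /negPf neji.
by rewrite mxE eq_sym neji scale0r.
Qed.

Lemma actK g : g \in unitmx -> cancel (act g) (act (invmx g)).
Proof. by move=> gU p; rewrite act_mul mulmxV // act1. Qed.

Lemma actVK g : g \in unitmx -> cancel (act (invmx g)) (act g).
Proof. by move=> gU p; rewrite act_mul mulVmx // act1. Qed.

Lemma act_homog g d p : p \is d.-homog -> act g p \is d.-homog.
Proof.
move=> /dhomogP hp; rewrite [p]mpolyE act_sum big_seq.
apply: rpred_sum => m /hp <-; rewrite actZ rpredZ //= act_mpolyX mdegE.
elim/big_rec2: _ => [|i e q _ IH]; first exact: dhomog1.
apply: dhomogM => //; rewrite -[X in X.-homog]mul1n; apply: dhomogMn; rewrite act_XU.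
by apply: rpred_sum => j _; rewrite rpredZ // dhomogX /= mdeg1.
Qed.

Lemma homog_partE d p : homog_part d p = pihomog mdeg d p.
Proof. by rewrite pihomogE. Qed.

Lemma act_homog_part g d p : homog_part d (act g p) = act g (homog_part d p).
Proof.
rewrite !homog_partE; pose k := maxn (msize p) d.+1.
rewrite [p in LHS](@pihomog_partitionE _ _ mdeg k) ?leq_maxl //.
have ltdk : (d < k)%N by rewrite leq_maxr.
rewrite act_sum (raddf_sum (pihomog mdeg d)) (bigD1 (Ordinal ltdk)) //= big1 ?addr0.
  by rewrite pihomog_dE // act_homog // pihomogP.
move=> e /eqP ned; rewrite (@pihomog_ne0 _ _ mdeg e) ?act_homog ?pihomogP //.
by apply/eqP => ed; apply: ned; apply: val_inj.
Qed.

Lemma mcoeff_homog_part d p m :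
  (homog_part d p)@_m = if mdeg m == d then p@_m else 0.
Proof.
rewrite homog_partE; case: eqP => [<-|ne]; last first.
  by rewrite (dhomog_nemf_coeff (pihomogP _ _ _)) //; apply/eqP.
pose k := maxn (msize p) (mdeg m).+1.
rewrite [p in RHS](@pihomog_partitionE _ _ mdeg k) ?leq_maxl //.
have ltdk : (mdeg m < k)%N by rewrite leq_maxr.
rewrite [in RHS](raddf_sum (mcoeff m)) (bigD1 (Ordinal ltdk)) //= big1 ?addr0 // => e /eqP ned.
rewrite (dhomog_nemf_coeff (pihomogP _ _ _)) //.
by apply/eqP => ed; apply: ned; apply: val_inj.
Qed.

Lemma msize_act g p : (msize (act g p) <= msize p)%N.
Proof.
rewrite [p in act g p]mpolyE act_sum.
apply: leq_trans (mmeasure_sum _ _ _ _) _; rewrite big_seq.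
elim/big_ind: _ => // [x y hx hy|m mp]; first by rewrite geq_max hx.
rewrite actZ (leq_trans (mmeasureZ_le _ _ _)) //.
apply: leq_trans (msize_mdeg_lt mp).
have /dhomogP hX : act g 'X_[m] \is (mdeg m).-homog by rewrite act_homog // dhomogX.
by rewrite msizeE big_seq; apply/bigmax_leqP_seq => u uX _; rewrite hX.
Qed.

Lemma act_graded_ideal g I : g \in unitmx -> graded_ideal I -> graded_ideal (act_ideal g I).
Proof.
move=> gU [[I0 ID IM] Ih]; split; first split.
- by exists 0; rewrite ?raddf0.
- by move=> _ _ [p Ip ->] [q Iq ->]; exists (p + q); [exact: ID | rewrite raddfD].
- move=> a _ [p Ip ->]; exists (act (invmx g) a * p); first exact: IM.
  by rewrite rmorphM /= actVK.
- by move=> _ [p Ip ->] d; exists (homog_part d p); [exact: Ih | rewrite act_homog_part].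
Qed.

End Action.

(** * Bases and dimension for spaces of polynomials *)

Section LinearFamilies.
Variables (K : fieldType) (n : nat).
Local Notation P := {mpoly K[n]}.
Local Notation mon := 'X_{1..n}.
Implicit Types (p q : P) (W I : P -> Prop) (le : rel mon).

Definition lincomb r (b : 'I_r -> P) (u : 'rV[K]_r) : P := \sum_i u 0 i *: b i.

Definition free_family r (b : 'I_r -> P) := forall u, lincomb b u = 0 -> u = 0.

Definition subspace W :=
  [/\ W 0, forall p q, W p -> W q -> W (p + q) & forall c p, W p -> W (c *: p)].

Definition is_basis W r (b : 'I_r -> P) :=
  [/\ forall i, W (b i), free_family b & forall p, W p -> exists u, p = lincomb b u].

Lemma mcoeff_lincomb r (b : 'I_r -> P) u m :
  (lincomb b u)@_m = \sum_i u 0 i * (b i)@_m.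
Proof.
by rewrite /lincomb (raddf_sum (mcoeff m)); apply: eq_bigr => i _; rewrite /= mcoeffZ.
Qed.

Lemma subspace_lincomb W r (b : 'I_r -> P) u :
  subspace W -> (forall i, W (b i)) -> W (lincomb b u).
Proof.
by move=> [W0 WD WZ] Wb; rewrite /lincomb; elim/big_rec: _ => // i p _ Wp; apply: WD => //; apply: WZ.
Qed.

Lemma row_free_ker r l (A : 'M[K]_(r, l)) :
  (forall u : 'rV_r, u *m A = 0 -> u = 0) -> row_free A.
Proof.
move=> injA; rewrite -kermx_eq0; apply/eqP/row_matrixP => i; rewrite row0.
by apply: injA; rewrite -row_mul mulmx_ker row0.
Qed.

Lemma ker_leq r l (A : 'M[K]_(r, l)) :
  (forall u : 'rV_r, u *m A = 0 -> u = 0) -> (r <= l)%N.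
Proof. by move/row_free_ker => /eqP <-; exact: rank_leq_col. Qed.

Lemma free_coord_leq r (b : 'I_r -> P) l (e : 'I_l -> mon) :
  (forall u, (forall j, (lincomb b u)@_(e j) = 0) -> u = 0) -> (r <= l)%N.
Proof.
move=> inj; apply: (@ker_leq _ _ (\matrix_(i, j) (b i)@_(e j))) => u uA; apply: inj => j.
move/rowP/(_ j): uA; rewrite !mxE mcoeff_lincomb => uA0; rewrite -[RHS]uA0.
by apply: eq_bigr => i _; rewrite mxE.
Qed.

Lemma free_basis_leq W r (b : 'I_r -> P) l (f : 'I_l -> P) :
  is_basis W b -> (forall i, W (f i)) -> free_family f -> (l <= r)%N.
Proof.
move=> [_ _ span] Wf free_f.
have /choice [c fE] : forall i, exists u, f i = lincomb b u by move=> i; apply: span.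
apply: (@ker_leq _ _ (\matrix_i c i)) => u uC; apply: free_f.
rewrite /lincomb; under eq_bigr => i _ do rewrite fE /lincomb scaler_sumr.
rewrite exchange_big big1 // => j _ /=; under eq_bigr => i _ do rewrite scalerA.
rewrite -scaler_suml; move/rowP/(_ j): uC; rewrite !mxE => uC.
rewrite (_ : \sum_i _ = 0) ?scale0r // -[RHS]uC.
by apply: eq_bigr => i _; rewrite mxE.
Qed.

(** Free families in [W] have at most as many members as there are monomials of degree at most [d];
    one of maximal size spans, since a vector outside its span could be prepended to it. *)
Lemma basis_trunc_exists W d : subspace W -> (forall p, W p -> (msize p <= d.+1)%N) ->
  exists r (b : 'I_r -> P), is_basis W b.
Proof.
move=> Wsub Wd.
pose Q r := `[< exists b : 'I_r -> P, (forall i, W (b i)) /\ free_family b >].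
have Q0 : exists r, Q r.
  exists 0%N; apply/asboolP; exists (fun=> 0); split; first by case.
  by move=> u _; apply/rowP; case.
have Qb r : Q r -> (r <= #|{: 'X_{1..n < d.+1}}|)%N.
  case/asboolP => b [Wb free_b].
  apply: (@free_coord_leq _ b _ (fun j => bmnm (enum_val j))) => u coord0; apply: free_b.
  apply/mpolyP => m; rewrite mcoeff0; have [ltm|lem] := ltnP (mdeg m) d.+1.
    by have := coord0 (enum_rank (BMultinom ltm)); rewrite enum_rankK.
  apply: memN_msupp_eq0; apply: msize_mdeg_ge; apply: leq_trans lem.
  by apply: Wd; apply: subspace_lincomb.
case: (ex_maxnP Q0 Qb) => r /asboolP [b [Wb free_b]] rmax.
exists r, b; split=> // p Wp; apply: contrapT => nspan.
suff /rmax : Q r.+1 by rewrite ltnn.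
apply/asboolP; exists (fun i => if unlift ord0 i is Some j then b j else p).
split=> [i|u]; first by case: unliftP.
rewrite /lincomb big_ord_recl unlift_none; under eq_bigr => i _ do rewrite liftK.
move=> u0; have [u00|nz] := eqVneq (u 0 ord0) 0.
  have : lincomb b (\row_j u 0 (lift ord0 j)) = 0.
    by rewrite -[RHS]u0 u00 scale0r add0r; apply: eq_bigr => i _; rewrite mxE.
  move/free_b/rowP => ul; apply/rowP => i; rewrite mxE.
  by case: (unliftP ord0 i) => [j|] ->; rewrite ?u00 //; have := ul j; rewrite !mxE.
case: nspan; exists (\row_j (- (u 0 ord0)^-1 * u 0 (lift ord0 j))).
apply: (scalerI nz); move/eqP: u0; rewrite addr_eq0 => /eqP ->.
rewrite /lincomb scaler_sumr -sumrN; apply: eq_bigr => i _.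
by rewrite mxE scalerA mulrA mulrN mulfV // mulN1r scaleNr.
Qed.

End LinearFamilies.

(** * Leading monomials and the dimension count for initial ideals *)

Section LeadingMonomials.
Variables (K : fieldType) (n : nat) (le : rel 'X_{1..n}) (le_to : term_order le).
Local Notation P := {mpoly K[n]}.
Implicit Types (p q : P) (m : 'X_{1..n}) (W I : P -> Prop).

Lemma seq_maximum (s : seq 'X_{1..n}) : s != [::] ->
  exists2 m, m \in s & forall m', m' \in s -> le m' m.
Proof.
case: le_to => [[refl _ trans tot] _].
elim: s => // m [|m1 s] IH _.
  by exists m => [|m']; rewrite inE // => /eqP ->.
have [//|M sM HM] := IH; case/orP: (tot m M) => leM.
  by exists M => [|m']; rewrite inE ?sM ?orbT // => /predU1P [->|/HM].
exists m => [|m']; rewrite inE ?eqxx // => /predU1P [->//|/HM lem'].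
exact: trans lem' leM.
Qed.

Lemma is_lm_exists p : p != 0 -> exists m, is_lm le p m.
Proof. by rewrite -msupp_eq0 => /seq_maximum [m pm maxm]; exists m. Qed.

Lemma is_lm_uniq p m m' : is_lm le p m -> is_lm le p m' -> m = m'.
Proof.
case: le_to => [[_ asym _ _] _] [pm maxm] [pm' maxm'].
by apply: asym; rewrite maxm // maxm'.
Qed.

Lemma is_lm_neq0 p m : is_lm le p m -> p != 0.
Proof. by case=> pm _; apply: contraTneq pm => ->; rewrite msupp0. Qed.

(** Among the indices with nonzero coefficient, the one with the largest leading monomial
    contributes a term that no other member can cancel. *)
Lemma lm_free l (p : 'I_l -> P) (m : 'I_l -> 'X_{1..n}) :
  injective m -> (forall i, is_lm le (p i) (m i)) -> free_family p.
Proof.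
move=> m_inj lm_p u u0; apply/eqP; apply: contraT => nzu.
have [i0 nzi0] : exists i, u 0 i != 0.
  apply: contrapT => /forallNP nex; case/negP: nzu; apply/eqP/rowP => i.
  by rewrite mxE; apply/eqP/contraT => nzi; case: (nex i).
pose s := [seq m i | i <- enum 'I_l & u 0 i != 0].
have [|M] := @seq_maximum s.
  have : m i0 \in s by apply: map_f; rewrite mem_filter nzi0 mem_enum.
  by case: s.
case/mapP => i; rewrite mem_filter => /andP [nzi _] ->{M} maxi.
move/mpolyP/(_ (m i)): u0; rewrite mcoeff_lincomb mcoeff0 (bigD1 i) //=.
rewrite big1 ?addr0 => [/eqP|j neji].
  by rewrite mulf_eq0 (negPf nzi) mcoeff_eq0 (lm_p i).1.
have [->|nzj] := eqVneq (u 0 j) 0; first by rewrite mul0r.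
rewrite memN_msupp_eq0 ?mulr0 //; apply: contra neji => /(lm_p j).2 leij.
case: le_to => [[_ asym _ _] _]; apply/eqP/m_inj/asym; rewrite leij andbT maxi //.
by apply: map_f; rewrite mem_filter nzj mem_enum.
Qed.

Definition initial_set I m := exists2 p, I p & is_lm le p m.

(** Elements with distinct leading monomials are free, which bounds the count by [r]. Conversely, an
    element of [W] with zero coefficient at every leading monomial of [W] vanishes. The count is
    thus the same for all term orders. *)
Lemma initial_card W d r (b : 'I_r -> P) :
  subspace W -> (forall p, W p -> (msize p <= d.+1)%N) -> is_basis W b ->
  hilbert_function (initial_set W) d = r.
Proof.
move=> Wsub Wd bW; rewrite /hilbert_function; set L := [set m : _ | _].
have LP (i : 'I_#|L|) : exists p, W p /\ is_lm le p (bmnm (enum_val i)).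
  by have := enum_valP i; rewrite inE => /asboolP [p]; exists p.
have [p Hp] := choice LP; apply/eqP; rewrite eqn_leq; apply/andP; split.
  apply: (free_basis_leq bW) (fun i => (Hp i).1) _.
  by apply: lm_free (fun i => (Hp i).2) => i j /val_inj /enum_val_inj.
have [Wb free_b _] := bW.
apply: (@free_coord_leq _ _ _ b _ (fun i : 'I_#|L| => bmnm (enum_val i))) => u coord0.
apply: free_b; apply/eqP; apply: contraT => /is_lm_exists [m lm_m].
have Wbu : W (lincomb b u) by apply: subspace_lincomb.
have ltm : (mdeg m < d.+1)%N by apply: leq_trans (Wd _ Wbu); apply: msize_mdeg_lt lm_m.1.
have Lm : BMultinom ltm \in L by rewrite inE; apply/asboolP; exists (lincomb b u).
have := coord0 (enum_rank_in Lm (BMultinom ltm)); rewrite enum_rankK_in //= => /eqP.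
by rewrite mcoeff_eq0 lm_m.1.
Qed.

Lemma is_lmXM p m u : is_lm le p m -> is_lm le (p * 'X_[u]) (m + u)%MM.
Proof.
case: le_to => [_ [_ le_add]] [pm maxm]; split=> [|m'].
  by rewrite (perm_mem (msuppMX _ _)); apply/mapP; exists m => //; rewrite addmC.
by rewrite (perm_mem (msuppMX _ _)) => /mapP [v /maxm vm ->]; rewrite addmC le_add.
Qed.

Lemma initial_monomial_ideal I : is_ideal I -> monomial_ideal (initial_set I).
Proof.
move=> [_ _ IM] m u [p Ip lm_p]; exists (p * 'X_[u]); last exact: is_lmXM.
by rewrite mulrC; apply: IM.
Qed.

Lemma is_lm_homog_part p m : is_lm le p m -> is_lm le (homog_part (mdeg m) p) m.
Proof.
move=> [pm maxm]; split=> [|m']; rewrite mcoeff_msupp mcoeff_homog_part.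
  by rewrite eqxx -mcoeff_msupp.
by case: ifP => _ nz; [apply: maxm; rewrite mcoeff_msupp | rewrite eqxx in nz].
Qed.

Definition trunc I d p := I p /\ (msize p <= d.+1)%N.

(** The term order may ignore degrees, so gradedness does the work: the homogeneous component of [p]
    containing [m] lies in [I] and retains [m] as leading monomial. *)
Lemma initial_trunc I d m : graded_ideal I -> (mdeg m <= d)%N ->
  initial_set I m -> initial_set (trunc I d) m.
Proof.
move=> [_ Ih] led [p Ip lm_p]; exists (homog_part (mdeg m) p); last exact: is_lm_homog_part.
split; first exact: Ih.
rewrite msizeE; apply/bigmax_leqP_seq => u + _.
by rewrite mcoeff_msupp mcoeff_homog_part; case: ifP => [/eqP ->//|_]; rewrite eqxx.
Qed.

End LeadingMonomials.

(** * Truncations of translated ideals and the uniform degree bound *)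

Section TruncatedIdeals.
Variables (K : fieldType) (n : nat).
Local Notation P := {mpoly K[n]}.
Implicit Types (p q : P) (I : P -> Prop) (g : 'M[K]_n).

Lemma ideal_scale I c p : is_ideal I -> I p -> I (c *: p).
Proof. by move=> [_ _ IM] Ip; rewrite -mul_mpolyC; apply: IM. Qed.

Lemma trunc_subspace I d : is_ideal I -> subspace (trunc I d).
Proof.
move=> II; have [I0 ID _] := II; split.
- by rewrite /trunc msize0.
- move=> p q [Ip dp] [Iq dq]; split; first exact: ID.
  by apply: leq_trans (msizeD_le _ _) _; rewrite geq_max dp.
- move=> c p [Ip dp]; split; first exact: ideal_scale.
  by apply: leq_trans dp; apply: mmeasureZ_le.
Qed.

Lemma trunc_act_basis I g d r (b : 'I_r -> P) : g \in unitmx ->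
  is_basis (trunc I d) b -> is_basis (trunc (act_ideal g I) d) (fun i => act g (b i)).
Proof.
move=> gU [Ib free_b span].
have act_lincomb u : lincomb (fun i => act g (b i)) u = act g (lincomb b u).
  by rewrite /lincomb act_sum; apply: eq_bigr => i _; rewrite actZ.
split=> [i|u|_ [[p Ip ->] dp]].
- have [Ibi dbi] := Ib i; split; first by exists (b i).
  exact: leq_trans (msize_act _ _) dbi.
- rewrite act_lincomb => u0; apply: free_b; rewrite -[LHS](actK gU) u0.
  exact: (raddf0 (act _)).
have [|u ->] := span p; last by exists u; rewrite act_lincomb.
by split=> //; rewrite -[p](actK gU); apply: leq_trans dp; apply: msize_act.
Qed.

Lemma initial_degree_bound I : graded_ideal I -> exists D, forall g le,
  g \in unitmx -> term_order le -> forall m, initial_set le (act_ideal g I) m ->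
  exists2 u, initial_set le (act_ideal g I) u & (mdeg u <= D)%N && (u <= m)%MM.
Proof.
move=> Igr.
have /choice [h Hh] : forall d, exists r, exists b : 'I_r -> P, is_basis (trunc I d) b.
  move=> d; apply: (@basis_trunc_exists _ _ _ d) => [|p []//].
  by apply: trunc_subspace; case: Igr.
(* [h d] is the dimension of the truncation of [I] at degree [d]. The action preserves these
   dimensions, so [D] serves every [g] and every order. *)
have [D HD] := gen_degree_bound n h; exists D => g le gU le_to.
have gIgr : graded_ideal (act_ideal g I) by apply: act_graded_ideal.
apply: HD; first by apply: initial_monomial_ideal => //; case: gIgr.
move=> d; have [b bI] := Hh d.
have gWd p : trunc (act_ideal g I) d p -> (msize p <= d.+1)%N by case.
rewrite -(initial_card le_to (trunc_subspace _ _) gWd (trunc_act_basis gU bI)); last by case: gIgr.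
apply: eq_card => m; rewrite !inE; apply/asboolP/asboolP.
  by apply: initial_trunc => //; rewrite -ltnS bmdeg.
by move=> [p [gIp _] lm_p]; exists p.
Qed.

End TruncatedIdeals.

(** * Polynomial functions of the matrix entries *)

Section PolynomialFunctions.
Variables (K : fieldType) (n : nat).
Local Notation P := {mpoly K[n]}.
Implicit Types (F G : 'M[K]_n -> K) (p q : P) (g : 'M[K]_n).

(** Uses the coordinates of [zariski_open_GL], so that the nonvanishing locus of such a function
    among invertible matrices is open. *)
Definition polyfun F := exists f : {mpoly K[n * n]}, forall g, F g = f.@[fun k => mxvec g 0 k].

Lemma eq_polyfun F G : F =1 G -> polyfun F -> polyfun G.
Proof. by move=> eFG [f Hf]; exists f => g; rewrite -eFG. Qed.

Lemma polyfunC c : polyfun (fun=> c).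
Proof. by exists c%:MP => g; rewrite mevalC. Qed.

Lemma polyfun_entry i j : polyfun (fun g => g i j).
Proof. by exists 'X_(mxvec_index i j) => g; rewrite mevalXU mxvecE. Qed.

Lemma polyfunD F G : polyfun F -> polyfun G -> polyfun (fun g => F g + G g).
Proof. by move=> [f Hf] [h Hh]; exists (f + h) => g; rewrite mevalD Hf Hh. Qed.

Lemma polyfunM F G : polyfun F -> polyfun G -> polyfun (fun g => F g * G g).
Proof. by move=> [f Hf] [h Hh]; exists (f * h) => g; rewrite mevalM Hf Hh. Qed.

Lemma polyfun_sum T (r : seq T) (Q : pred T) (F : T -> 'M[K]_n -> K) :
  (forall i, polyfun (F i)) -> polyfun (fun g => \sum_(i <- r | Q i) F i g).
Proof.
move=> HF; elim: r => [|i r IH]; first by apply: eq_polyfun (polyfunC 0) => g; rewrite big_nil.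
case Qi: (Q i); last by apply: eq_polyfun IH => g; rewrite big_cons Qi.
by apply: eq_polyfun (polyfunD (HF i) IH) => g; rewrite big_cons Qi.
Qed.

Lemma polyfun_prod T (r : seq T) (F : T -> 'M[K]_n -> K) :
  (forall i, polyfun (F i)) -> polyfun (fun g => \prod_(i <- r) F i g).
Proof.
move=> HF; elim: r => [|i r IH]; first by apply: eq_polyfun (polyfunC 1) => g; rewrite big_nil.
by apply: eq_polyfun (polyfunM (HF i) IH) => g; rewrite big_cons.
Qed.

Lemma polyfun_det r (M : 'M[K]_n -> 'M[K]_r) :
  (forall i j, polyfun (fun g => M g i j)) -> polyfun (fun g => \det (M g)).
Proof.
move=> HM; apply: polyfun_sum => s; apply: polyfunM; first exact: polyfunC.
by apply: polyfun_prod => i; apply: HM.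
Qed.

Definition coef_polyfun (Q : 'M[K]_n -> P) := forall m, polyfun (fun g => (Q g)@_m).

Lemma coef_polyfunM Q R : coef_polyfun Q -> coef_polyfun R -> coef_polyfun (fun g => Q g * R g).
Proof.
move=> HQ HR m; apply: eq_polyfun; first by move=> g; rewrite mcoeffM; reflexivity.
by apply: polyfun_sum => k; apply: polyfunM; [exact: HQ | exact: HR].
Qed.

Lemma coef_polyfun_act p : coef_polyfun (fun g => act g p).
Proof.
have actX m0 : coef_polyfun (fun g => act g 'X_[m0]).
  have -> : (fun g => act g 'X_[m0]) = (fun g => \prod_(i < n) (act g 'X_i) ^+ m0 i).
    by apply: funext => g; rewrite act_mpolyX.
  rewrite /index_enum; elim: (Finite.enum _) => [|i r IH].
    move=> m; apply: eq_polyfun (polyfunC (1 : P)@_m) => g; rewrite big_nil //.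
  have -> : (fun g => \prod_(j <- i :: r) (act g 'X_j) ^+ m0 j) =
            (fun g => act g 'X_i ^+ m0 i * \prod_(j <- r) (act g 'X_j) ^+ m0 j).
    by apply: funext => g; rewrite big_cons.
  apply: coef_polyfunM IH; elim: (m0 i) => [|k IHk] m.
    by apply: eq_polyfun (polyfunC (1 : P)@_m) => g; rewrite expr0.
  apply: eq_polyfun; first by move=> g; rewrite exprS; reflexivity.
  apply: coef_polyfunM IHk _ => {}m.
  apply: eq_polyfun; first by move=> g; rewrite act_XU (raddf_sum (mcoeff m)); reflexivity.
  apply: polyfun_sum => j; apply: eq_polyfun; first by move=> g; rewrite /= mcoeffZ; reflexivity.
  by apply: polyfunM; [exact: polyfun_entry | exact: polyfunC].
move=> m; apply: eq_polyfun.
  by move=> g; rewrite [p in act g p]mpolyE act_sum (raddf_sum (mcoeff m)); reflexivity.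
apply: polyfun_sum => u; apply: eq_polyfun; first by move=> g; rewrite /= actZ mcoeffZ; reflexivity.
by apply: polyfunM; [exact: polyfunC | exact: actX].
Qed.

(** Restriction to the line through [a] and [b] turns nonvanishing on matrix space into a question
    on univariate polynomials. *)
Lemma polyfun_line F a b : polyfun F ->
  exists q : {poly K}, forall t, F (a + t *: (b - a)) = q.[t].
Proof.
move=> [f Hf]; pose l k := (mxvec a 0 k)%:P + 'X * (mxvec (b - a) 0 k)%:P.
suff [q Hq] : exists q : {poly K}, forall t, f.@[fun k => (l k).[t]] = q.[t].
  exists q => t; rewrite Hf -Hq; apply: meval_eq => k.
  by rewrite linearD linearZ /= !mxE !hornerE.
elim/mpolyind: f {Hf} => [|c m f _ _ [q Hq]]; first by exists 0 => t; rewrite meval0 horner0.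
exists (c%:P * (\prod_k l k ^+ m k) + q) => t.
rewrite mevalD mevalZ mevalX Hq hornerD hornerM hornerC horner_prod; congr (_ * _ + _).
by apply: eq_bigr => k _; rewrite horner_exp.
Qed.

End PolynomialFunctions.

(** * Common nonvanishing of polynomial functions *)

Section GenericPoints.
Variables (K : closedFieldType) (n : nat).

(** This is the irreducibility of matrix space. On the line from [a] to [b] the restrictions are
    nonzero at parameters 0 and 1 respectively, and their nonzero product has a non-root over an
    algebraically closed field. *)
Lemma polyfun_meet F G (a b : 'M[K]_n) : polyfun F -> polyfun G ->
  F a != 0 -> G b != 0 -> exists c, F c * G c != 0.
Proof.
move=> /(polyfun_line a b) [p Hp] /(polyfun_line a b) [q Hq] nzF nzG.
have [t /rootP/eqP nrt] : exists t, ~~ root (p * q) t.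
  apply/closed_nonrootP; rewrite mulf_neq0 //.
    by apply: contraNneq nzF => p0; rewrite -[a]addr0 -(scale0r (b - a)) Hp p0 horner0.
  apply: contraNneq nzG => q0; rewrite (_ : b = a + 1 *: (b - a)) ?Hq ?q0 ?horner0 //.
  by rewrite scale1r addrC subrK.
by exists (a + t *: (b - a)); rewrite Hp Hq -hornerM.
Qed.

Lemma polyfun_generic (T : eqType) (r : seq T) (F : T -> 'M[K]_n -> K) :
  (forall i, polyfun (F i)) -> (forall i, exists g, F i g != 0) ->
  exists g, \prod_(i <- r) F i g != 0.
Proof.
move=> HF nzF; elim: r => [|i r [g IH]]; first by exists 0; rewrite big_nil oner_eq0.
have [a nza] := nzF i; have [c] := polyfun_meet (HF i) (polyfun_prod r HF) nza IH.
by exists c; rewrite big_cons.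
Qed.

End GenericPoints.

(** * Circuits, universal Gröbner bases and openness of independence *)

Section Circuits.
Variables (K : fieldType) (n D : nat).
Local Notation P := {mpoly K[n]}.
Local Notation mon := 'X_{1..n < D.+1}.
Implicit Types (p v : P) (I J : P -> Prop) (S : {set mon}) (g : 'M[K]_n).

(** The monomials in [S] have degree at most [D], so this builds in the degree truncation. *)
Definition supported S v := forall m, m \in msupp v -> exists2 t, t \in S & m = bmnm t.

(** For an ideal [J], these are the dependent sets of a linear matroid: that of the classes of the
    monomials of degree at most [D] modulo the truncation of [J]. *)
Definition dependent J S := exists v, [/\ J v, v != 0 & supported S v].

Definition circuit J S := dependent J S /\ forall S', S' \proper S -> ~ dependent J S'.

Definition circuits J : {set {set mon}} := [set S | `[< circuit J S >]].

Definition support_sets (C : {set {set mon}}) : {fset {fset 'X_{1..n}}} :=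
  [fset [fset bmnm t | t in S]%fset | S : {set mon} in C]%fset.

Lemma eq_circuits J J' : (forall S, dependent J S <-> dependent J' S) -> circuits J = circuits J'.
Proof.
move=> eJ; apply/setP => S; rewrite !inE; apply: asbool_equiv_eq.
by split=> -[/eJ depS minS]; split=> // S' /minS nd /eJ.
Qed.

Definition support_set v : {set mon} := [set t : mon | bmnm t \in msupp v].

Lemma supported_support_set v : (msize v <= D.+1)%N -> supported (support_set v) v.
Proof.
move=> dv m vm; exists (BMultinom (leq_trans (msize_mdeg_lt vm) dv)) => //.
by rewrite inE.
Qed.

Lemma supported_sub S v : supported S v -> support_set v \subset S.
Proof.
move=> supp_v; apply/subsetP => t; rewrite inE => /supp_v [t' St' /val_inj ->] //.
Qed.

Lemma supported_msize S v : supported S v -> (msize v <= D.+1)%N.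
Proof.
move=> supp_v; rewrite msizeE; apply/bigmax_leqP_seq => m + _ => /supp_v [t _ ->].
exact: bmdeg.
Qed.

(** Otherwise the support of [v] would be a smaller dependent set, against minimality. *)
Lemma circuit_support J S v : circuit J S -> J v -> v != 0 -> supported S v -> support_set v = S.
Proof.
move=> [_ minS] Jv nzv supp_v; apply/eqP; apply: contraT => ne.
have /minS : support_set v \proper S by rewrite properEneq ne supported_sub.
case; exists v; split=> //; apply: supported_support_set; exact: supported_msize supp_v.
Qed.

Lemma mpoly_supp_support_set v : (msize v <= D.+1)%N ->
  mpoly_supp v = [fset bmnm t | t in support_set v]%fset.
Proof.
move=> dv; apply/fsetP => m; apply/idP/idP.
  rewrite !inE /= => vm; have [t St ->] := supported_support_set dv vm.
  by apply/imfsetP; exists t.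
by case/imfsetP => t /=; rewrite !inE => vt ->.
Qed.

(* Cancelling a coefficient of [v] against an element with strictly smaller
   support either keeps the leading monomial or exhibits it in that element, so
   an element with a given leading monomial and minimal support is a circuit. *)
Lemma circuit_lm le J m : term_order le -> is_ideal J ->
  initial_set le (trunc J D) m ->
  exists S, circuit J S /\ forall v, J v -> v != 0 -> supported S v -> is_lm le v m.
Proof.
move=> le_to JI [v0 [Jv0 dv0] lm_v0].
pose Q k := `[< exists v, [/\ J v, (msize v <= D.+1)%N, is_lm le v m & #|support_set v| = k] >].
have exQ : exists k, Q k by exists #|support_set v0|; apply/asboolP; exists v0.
case: (ex_minnP exQ) => k /asboolP [v [Jv dv lm_v <-]] {k}minv.
have min_supp w : J w -> support_set w \proper support_set v -> supported (support_set v) w ->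
    ~ is_lm le w m.
  move=> Jw /proper_card ltw supp_w lm_w; move: ltw; rewrite ltnNge minv //.
  by apply/asboolP; exists w; split=> //; apply: supported_msize supp_w.
have minS S : S \proper support_set v -> ~ dependent J S.
  move=> ltS [w [Jw nzw supp_w]].
  have supp_vw : supported (support_set v) w.
    by move=> m' /supp_w [t St ->]; exists t => //; apply: (subsetP (proper_sub ltS)).
  have lt_w : support_set w \proper support_set v by apply: sub_proper_trans (supported_sub supp_w) ltS.
  have max_w m' : m' \in msupp w -> le m' m.
    by case/supp_vw => t; rewrite inE => /lm_v.2 let_ ->.
  have [wm|nwm] := boolP (m \in msupp w); first by case: (min_supp w).
  have [m1 [w_m1 _]] := is_lm_exists le_to nzw.
  pose c := v@_m1 / w@_m1; pose v' := v - c *: w.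
  have Jv' : J v'.
    case: (JI) => _ JD JM; apply: JD => //.
    by rewrite -scaleNr; apply: ideal_scale.
  have supp_v' : supported (support_set v) v'.
    move=> m' /msuppB_le; rewrite mem_cat => /orP [|/msuppZ_le]; last exact: supp_vw.
    exact: supported_support_set.
  have v'm1 : v'@_m1 = 0.
    by rewrite mcoeffB mcoeffZ divfK ?subrr // -mcoeff_msupp.
  apply: (min_supp v') => //; last split.
  - apply/properP; split; first exact: supported_sub.
    have [t St em1] := supp_vw _ w_m1; exists t => //.
    by rewrite inE -em1 mcoeff_msupp v'm1 eqxx.
  - by rewrite mcoeff_msupp mcoeffB mcoeffZ (memN_msupp_eq0 nwm) mulr0 subr0 -mcoeff_msupp lm_v.1.
  - by move=> m' /supp_v' [t]; rewrite inE => /lm_v.2 let_ ->.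
exists (support_set v); have circ : circuit J (support_set v).
  split=> //; exists v; split=> //; first exact: is_lm_neq0 lm_v.
  exact: supported_support_set.
(* Nonzero elements supported in a circuit have it as full support, hence share the leading monomial
   of [v]. *)
split=> // w Jw nzw supp_w; have eS := circuit_support circ Jw nzw supp_w.
have memS m' : (m' \in msupp w) = (m' \in msupp v).
  apply/idP/idP => [/supp_w [t]|/(supported_support_set dv) [t]].
    by rewrite inE => ? ->.
  by rewrite -{1}eS inE => ? ->.
by split=> [|m']; rewrite memS; [exact: lm_v.1 | exact: lm_v.2].
Qed.

Lemma gen_ideal_sub J G p : is_ideal J -> (forall h, h \in G -> J h) -> gen_ideal G p -> J p.
Proof.
move=> [J0 JD JM] GJ [a [_ ->]]; elim/big_rec: _ => // i q _ Jq.
by apply: JD => //; apply/JM/GJ/mem_nth.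
Qed.

Lemma gen_idealD (G : seq P) h q c : h \in G -> gen_ideal G q -> gen_ideal G (c * h + q).
Proof.
move=> Gh [a [sa ->]]; have lti : (index h G < size G)%N by rewrite index_mem.
(* Only the position [index h G] is changed, so a repeated [h] receives the extra coefficient
   once. *)
exists [seq a`_i + (if i == index h G then c else 0) | i <- iota 0 (size G)].
rewrite size_map size_iota; split=> //.
under [RHS]eq_bigr => i _ do rewrite (nth_map 0%N) ?size_iota // nth_iota // add0n mulrDl.
rewrite big_split /= addrC; congr (_ + _).
rewrite (bigD1 (Ordinal lti)) //= eqxx nth_index // big1 ?addr0 // => i nei.
by rewrite ifN ?mul0r //; apply: contraNneq nei => ei; apply/eqP/val_inj.
Qed.

Lemma mnmc_term_order : term_order (fun m1 m2 : 'X_{1..n} => (m1 <= m2)%O).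
Proof.
split; split; [exact: lexx | exact: le_anti | exact: le_trans | exact: le_total | |].
  exact: le0m.
by move=> m1 m2 m; rewrite lemc_add2l.
Qed.

(** Division algorithm: subtracting a multiple of a suitable [h] cancels the leading term of [p],
    and the remainder vanishes or has a smaller leading monomial. *)
Lemma groebner_basis_gen J G p : is_ideal J ->
  groebner_basis (fun m1 m2 : 'X_{1..n} => (m1 <= m2)%O) J G -> J p -> gen_ideal G p.
Proof.
move=> JI [GJ GB]; elim/mleadrect: p => p IH Jp.
have gen0 : gen_ideal G 0.
  exists (nseq (size G) 0); rewrite size_nseq; split=> //.
  by rewrite big1 // => i _; rewrite nth_nseq if_same mul0r.
have [->//|nzp] := eqVneq p 0.
have [h [mh [mp [Gh lm_h lm_p divhp]]]] := GB p Jp nzp.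
have emp : mp = mlead p.
  apply: (is_lm_uniq mnmc_term_order lm_p); split; first exact: mlead_supp.
  by move=> m'; apply: msupp_le_mlead.
pose u := (mp - mh)%MM; pose c := p@_mp / h@_mh.
have emh : (mh + u)%MM = mp by rewrite addmC submK //; apply/mnm_lepP.
have nzh : h@_mh != 0 by rewrite -mcoeff_msupp lm_h.1.
pose q := p - (c *: 'X_[u]) * h.
rewrite -[p](subrK ((c *: 'X_[u]) * h)) addrC; apply: gen_idealD => //; rewrite -/q.
have Jq : J q.
  case: (JI) => _ JD JM; apply: JD => //.
  by rewrite -mulNr; apply: JM; apply: GJ.
have hu := is_lmXM mnmc_term_order u lm_h.
have chE : (c *: 'X_[u] * h)@_mp = p@_mp.
  have := mcoeffMX h u mh; rewrite addmC emh => hX.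
  by rewrite -scalerAl mcoeffZ ['X_[u] * h]mulrC hX divfK.
have q_le m' : m' \in msupp q -> (m' < mp)%O.
  move=> qm'; rewrite lt_neqAle; apply/andP; split.
    by apply: contraTneq qm' => ->; rewrite -mcoeff_eq0 mcoeffB chE subrr.
  move/msuppB_le: qm'; rewrite mem_cat => /orP [/lm_p.2 //|].
  rewrite -scalerAl => /msuppZ_le; rewrite mulrC -emh => /hu.2 //.
have [->//|nzq] := eqVneq q 0.
by apply: IH => //; rewrite -emp; apply/q_le/mlead_supp.
Qed.

(** One element is taken per circuit. By the degree bound every leading monomial is divisible by one
    of degree at most [D], which [circuit_lm] realizes on a circuit. *)
Lemma circuits_universal_GB J : graded_ideal J ->
  (forall le, term_order le -> forall m, initial_set le J m ->
     exists2 u, initial_set le J u & (mdeg u <= D)%N && (u <= m)%MM) ->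
  exists G, universal_GB J G /\ supp_set G = support_sets (circuits J).
Proof.
move=> Jgr deg_bound; have [JI _] := Jgr.
have /choice [c Hc] : forall S, exists v, circuit J S -> [/\ J v, v != 0 & supported S v].
  move=> S; have [[[v Hv] _]|nS] := pselect (circuit J S); first by exists v.
  by exists 0.
pose G := [seq c A | A <- enum (circuits J)].
have GP h : h \in G -> exists2 S, circuit J S & h = c S.
  by case/mapP => S; rewrite mem_enum inE => /asboolP cS ->; exists S.
have GJ h : h \in G -> J h by case/GP => S /Hc [JcS _ _] ->.
have GB le : term_order le -> groebner_basis le J G.
  move=> le_to; split=> // p Jp nzp; have [mp lm_p] := is_lm_exists le_to nzp.
  have [|mh inJ /andP [dmh divh]] := deg_bound le le_to mp; first by exists p.
  have [S [cS lmS]] := circuit_lm le_to JI (initial_trunc Jgr dmh inJ).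
  have [JcS nzcS suppcS] := Hc S cS.
  exists (c S), mh, mp; split=> //; [|exact: lmS|exact/mnm_lepP].
  by apply: map_f; rewrite mem_enum inE; apply/asboolP.
exists G; split; first split=> // p; first split.
- by move=> Jp; apply: groebner_basis_gen JI (GB _ mnmc_term_order) Jp.
- exact: gen_ideal_sub.
have suppE S : circuit J S -> mpoly_supp (c S) = [fset bmnm t | t in S]%fset.
  move=> cS; have [JcS nzcS suppcS] := Hc S cS.
  by rewrite (mpoly_supp_support_set (supported_msize suppcS)) (circuit_support cS).
apply/fsetP => F; apply/imfsetP/imfsetP => /= -[].
  move=> h /GP [S cS ->] ->; exists S; last exact: suppE.
  by rewrite inE; apply/asboolP.
move=> S; rewrite inE => /asboolP cS ->; exists (c S); last by rewrite suppE.
by apply: map_f; rewrite mem_enum inE; apply/asboolP.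
Qed.

(** Independence of [S] says that the coefficients outside [S] determine an element of the
    truncation, so that a matrix depending polynomially on [g] has full row rank. *)
Lemma independent_open I S g0 : graded_ideal I -> g0 \in unitmx ->
  ~ dependent (act_ideal g0 I) S ->
  exists F : 'M[K]_n -> K, [/\ polyfun F, F g0 != 0 &
    forall g, g \in unitmx -> F g != 0 -> ~ dependent (act_ideal g I) S].
Proof.
move=> [II Ih] g0U indep0.
have [||r [b bI]] := @basis_trunc_exists _ _ (trunc I D) D; first exact: trunc_subspace.
  by move=> p [].
(* Columns indexed by [S] are zeroed rather than deleted: the left kernel is the same, and columns
   stay indexed by all monomials. *)
pose M g := \matrix_(i < r, j < #|{: mon}|)
  if enum_val j \in S then 0 else (act g (b i))@_(bmnm (enum_val j)).
have M_ker g u : u *m M g = 0 <-> forall t : mon, t \notin S -> (act g (lincomb b u))@_t = 0.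
  have ME t : t \notin S -> (u *m M g) 0 (enum_rank t) = (act g (lincomb b u))@_(bmnm t).
    move=> nSt; rewrite mxE /lincomb act_sum (raddf_sum (mcoeff _)) /=.
    by apply: eq_bigr => i _; rewrite mxE enum_rankK (negPf nSt) actZ mcoeffZ.
  split=> [uM t nSt|H]; first by rewrite -ME // uM mxE.
  apply/rowP => j; rewrite [RHS]mxE -[j]enum_valK.
  have [St|nSt] := boolP (enum_val j \in S); last by rewrite ME // H.
  by rewrite mxE big1 // => i _; rewrite mxE enum_rankK St mulr0.
have free0 : row_free (M g0).
  apply: row_free_ker => u /M_ker supp_u; case: bI => Ib free_b _.
  apply: free_b; apply/eqP; apply: contraT => nzu; case: indep0.
  have [Iu du] : trunc I D (lincomb b u) by apply: subspace_lincomb => //; apply: trunc_subspace.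
  exists (act g0 (lincomb b u)); split; first by exists (lincomb b u).
    apply: contraNneq nzu => u0; rewrite -[X in X == _](actK g0U) u0.
    by rewrite (raddf0 (act _)).
  move=> m um; have dm := leq_trans (msize_mdeg_lt um) (leq_trans (msize_act _ _) du).
  exists (BMultinom dm) => //; apply: contraTT um => nS.
  by rewrite -mcoeff_eq0; apply/eqP/(supp_u (BMultinom dm)).
(* The right inverse [B] of [M g0] stays fixed: [\det (M g *m B)] is polynomial in [g], equals 1 at
   [g0], and where it is nonzero [M g] has a right inverse too. *)
have [B MB] := row_freeP free0.
exists (fun g => \det (M g *m B)); split.
- apply: polyfun_det => i j; apply: eq_polyfun; first by move=> g; rewrite mxE; reflexivity.
  apply: polyfun_sum => k; apply: polyfunM; last exact: polyfunC.
  apply: eq_polyfun; first by move=> g; rewrite mxE; reflexivity.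
  case: (_ \in S); [exact: polyfunC | exact: coef_polyfun_act].
- by rewrite MB det1 oner_eq0.
move=> g gU nzdet [v [[p Ip ev] nzv suppv]].
have freeM : row_free (M g).
  by apply/row_freeP; exists (B *m invmx (M g *m B)); rewrite mulmxA mulmxV // unitmxE unitfE.
have [_ _ span] := bI; have [|u eu] := span p.
  split=> //; rewrite -[p](actK gU) -ev.
  by apply: leq_trans (msize_act _ _) _; apply: supported_msize suppv.
case/negP: nzv; rewrite ev eu.
have -> : u = 0.
  apply: (row_free_inj freeM); rewrite mul0mx; apply/M_ker => t nSt; rewrite -eu -ev.
  apply: memN_msupp_eq0; apply: contra nSt => /suppv [t' St' /val_inj ->] //.
by rewrite /lincomb big1 ?(raddf0 (act _)) // => i _; rewrite mxE scale0r.
Qed.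

End Circuits.

(** * The generic open set and the constancy of supports on it *)

Theorem theorem3p1 (K : closedFieldType) (hK : [pchar K] =i pred0) (n : nat)
    (I : {mpoly K[n]} -> Prop) (hI : graded_ideal I) :
  exists U : 'M[K]_n -> Prop,
    [/\ zariski_open_GL U, (exists g, U g) &
      exists G : 'M[K]_n -> seq {mpoly K[n]},
        (forall g, U g -> universal_GB (act_ideal g I) (G g)) /\
        (forall g1 g2, U g1 -> U g2 -> supp_set (G g1) = supp_set (G g2))].
Proof.
have [D HD] := initial_degree_bound hI.
pose generic_indep (S : {set 'X_{1..n < D.+1}}) :=
  exists2 g0, g0 \in unitmx & ~ dependent (act_ideal g0 I) S.
have /choice [F HF] : forall S, exists F : 'M[K]_n -> K, [/\ polyfun F, exists g, F g != 0 &
    generic_indep S -> forall g, g \in unitmx -> F g != 0 -> ~ dependent (act_ideal g I) S].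
  move=> S; have [[g0 g0U indep0]|nS] := pselect (generic_indep S).
    by have [F [pF nzF HF]] := independent_open hI g0U indep0; exists F; split=> //; exists g0.
  (* A set that is dependent for every invertible [g] imposes no condition, hence the constant 1. *)
  by exists (fun=> 1); split=> //; [exact: polyfunC | exists 0; exact: oner_neq0].
pose F' g := \prod_(S <- enum {set 'X_{1..n < D.+1}}) F S g.
have pF S : polyfun (F S) by case: (HF S).
have pF' : polyfun F' by apply: polyfun_prod.
pose U g := g \in unitmx /\ F' g != 0.
(* On [U] dependence is decided by a criterion that does not mention [g], so the circuits are the
   same throughout [U]. *)
have dep_generic g S : U g -> dependent (act_ideal g I) S <-> ~ generic_indep S.
  move=> [gU]; rewrite /F' prodf_seq_neq0 => /allP /(_ S).
  rewrite mem_enum => /(_ isT) /= nzFS; split=> [dep indepS|nindep].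
    by case: (HF S) => _ _ /(_ indepS g gU nzFS).
  by apply: contrapT => ndep; apply: nindep; exists g.
exists U; split.
- have [f Hf] := pF'; exists (fun h => h = f) => g; split=> [[gU nzF]|[gU [h -> nzh]]].
    by split=> //; exists f; rewrite // -Hf.
  by split=> //; rewrite Hf.
(* The determinant joins the functions so that the common nonzero point is invertible. *)
- have pdet : polyfun (fun g : 'M[K]_n => \det g).
    by apply: polyfun_det => i j; apply: polyfun_entry.
  have nzF S : exists g, F S g != 0 by case: (HF S).
  have [g0 nz0] := polyfun_generic (enum {set 'X_{1..n < D.+1}}) pF nzF.
  have [|g] := polyfun_meet pdet pF' (_ : \det 1%:M != 0) nz0; first by rewrite det1 oner_eq0.
  rewrite mulf_eq0 negb_or => /andP [nzdet nzFg]; exists g; split=> //.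
  by rewrite unitmxE unitfE.
have /choice [G HG] : forall g, exists G, U g -> universal_GB (act_ideal g I) G /\
    supp_set G = support_sets (circuits D (act_ideal g I)).
  move=> g; have [[gU _]|nU] := pselect (U g); last by exists [::].
  have [|le le_to|G HG] := @circuits_universal_GB _ _ D (act_ideal g I).
  - exact: act_graded_ideal.
  - exact: HD.
  by exists G.
exists G; split=> [g /HG []//|g1 g2 U1 U2].
rewrite (HG g1 U1).2 (HG g2 U2).2; congr support_sets; apply: eq_circuits => S.
by rewrite (dep_generic g1) // (dep_generic g2).
Qed.
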